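(* Let $\mathcal{C}$ be a class of $N$ subsets of $\{1,\ldots,n\}$, each of cardinality $K\ge 1$, and let $\mu>0$. For $\mathbf{x}\in\mathbb{R}^n$ and $S\in\mathcal{C}$ write $x_S=\sum_{i\in S}x_i$ and $X_S=\sum_{i\in S}X_i$. Let $f:\mathbb{R}^n\to\{0,1\}$ be the maximum test defined by $$f(\mathbf{x})=1\quad\text{if and only if}\quad \max_{S\in\mathcal{C}}x_S\ \ge\ \frac{\mu K+\mathbb{E}_0\max_{S\in\mathcal{C}}X_S}{2}.$$ Let $0<\delta\le 2$. Then $R(f)\le\delta$ whenever $$\mu\ \ge\ \frac{\mathbb{E}_0\max_{S\in\mathcal{C}}X_S}{K}+2\sqrt{\frac{2}{K}\log\frac{2}{\delta}}.$$
   Context: Setting: $n\ge1$, and $\mathcal{C}=\{S_1,\ldots,S_N\}$ is a class of $N\ge 1$ distinct subsets of $\{1,\ldots,n\}$, all of the same cardinality $K$. One observes a random vector $\mathbf{X}=(X_1,\ldots,X_n)$. Under $\mathbb{P}_0$ (with expectation $\mathbb{E}_0$), the components of $\mathbf{X}$ are independent standard normal. For $S\in\mathcal{C}$, under $\mathbb{P}_S$ the components are independent with $X_i\sim\mathcal{N}(\mu,1)$ for $i\in S$ and $X_i\sim\mathcal{N}(0,1)$ for $i\notin S$, where $\mu>0$. A test is a (measurable) function $f:\mathbb{R}^n\to\{0,1\}$, and its risk is $$R(f)=\mathbb{P}_0\{f(\mathbf{X})=1\}+\frac1N\sum_{S\in\mathcal{C}}\mathbb{P}_S\{f(\mathbf{X})=0\}.$$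 *)

(* Defs.v *)
From HB Require Import structures.
From mathcomp Require Import all_boot all_order all_algebra.
From mathcomp Require Import all_classical all_reals all_analysis.
From mathcomp Require Import measurable_realfun.
Set Implicit Arguments.
Unset Strict Implicit.
Unset Printing Implicit Defensive.
Import Order.TTheory GRing.Theory Num.Theory.
Local Open Scope classical_set_scope.
Local Open Scope ring_scope.

Definition coord_sum (R : realType) (n : nat) (x : n.-tuple R) (S : {set 'I_n}) : R :=
  \sum_(i in S) tnth x i.

(* The maximum of x_S over S in C.  The base value of the iterated maximum is
   x_S for some S in C, so that this is the true maximum as soon as C is not
   empty, see max_coord_sum_ub and max_coord_sum_attained. *)
Definition max_coord_sum (R : realType) (n : nat) (C : {set {set 'I_n}})
    (x : n.-tuple R) : R :=
  \big[Num.max/coord_sum x (odflt finset.set0 [pick S in C])]_(S in C) coord_sum x S.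

Lemma max_coord_sum_ub (R : realType) (n : nat) (C : {set {set 'I_n}})
    (x : n.-tuple R) (S : {set 'I_n}) :
  S \in C -> coord_sum x S <= max_coord_sum C x.
Proof. by move=> SC; apply: (@le_bigmax_cond _ _ _ _ _ (mem C)). Qed.

Lemma max_coord_sum_attained (R : realType) (n : nat) (C : {set {set 'I_n}})
    (x : n.-tuple R) : C != finset.set0 ->
  exists2 S, S \in C & max_coord_sum C x = coord_sum x S.
Proof.
move=> C0; rewrite /max_coord_sum.
case: pickP => [S0 S0C|/= C_empty]; last first.
  by case/set0Pn: C0 => S; rewrite C_empty.
apply: (big_ind (fun m => exists2 S, S \in C & m = coord_sum x S)).
- by exists S0.
- move=> _ _ [S SC ->] [S' S'C ->].
  by rewrite maxEle; case: ifP => _; [exists S'|exists S].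
- by move=> S SC; exists S.
Qed.

Lemma measurable_max_coord_sum (R : realType) (n : nat) (C : {set {set 'I_n}}) :
  measurable_fun [set: n.-tuple R] (@max_coord_sum R n C).
Proof.
have mS S : measurable_fun [set: n.-tuple R]
    (fun x : n.-tuple R => coord_sum (x : n.-tuple R) S).
  under eq_fun do rewrite /coord_sum big_mkcond /=.
  apply: (@measurable_sum _ _ R setT _ _
    (fun i (x : n.-tuple R) => if i \in S then tnth x i else 0)).
  by move=> i; case: (i \in S) => //; exact: measurable_tnth.
rewrite /max_coord_sum; move: (odflt _ _) => S0.
under eq_fun do rewrite unlock /=.
elim: (index_enum _) => [|S s IHs] /=; first exact: mS.
by case: (S \in C) => //=; apply: measurable_maxr.
Qed.

(* The maximum test with threshold t; the value true stands for 1. *)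
Definition max_test (R : realType) (n : nat) (C : {set {set 'I_n}}) (t : R)
    (x : n.-tuple R) : bool :=
  t <= max_coord_sum C x.

Lemma measurable_max_test (R : realType) (n : nat) (C : {set {set 'I_n}}) (t : R) :
  measurable_fun [set: n.-tuple R] (max_test C t).
Proof.
by apply: measurable_fun_ler => //; exact: measurable_max_coord_sum.
Qed.

HB.instance Definition _ (R : realType) (n : nat) (C : {set {set 'I_n}}) (t : R) :=
  isMeasurableFun.Build _ _ _ _ (@max_test R n C t) (@measurable_max_test R n C t).

Definition mutually_independent (d : measure_display) (T : measurableType d)
    (R : realType) (P : probability T R) (I : finType) (Y : I -> T -> R) : Prop :=
  forall (J : {set I}) (B : I -> set R),
    (forall i, i \in J -> measurable (B i)) ->
    P (\bigcap_(i in [set` J]) (Y i @^-1` B i)) =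
    (\prod_(i in J) P (Y i @^-1` B i))%E.

(* The second parameter of normal_prob is the standard deviation. *)
Definition indep_normal (d : measure_display) (T : measurableType d)
    (R : realType) (n : nat) (P : probability T R)
    (X : T -> n.-tuple R) (m : 'I_n -> R) : Prop :=
  mutually_independent P (fun i w => tnth (X w) i) /\
  forall (i : 'I_n) (B : set R), measurable B ->
    P ((fun w => tnth (X w) i) @^-1` B) = normal_prob (m i) 1 B.

Definition shifted_mean (R : realType) (n : nat) (mu : R) (S : {set 'I_n})
    (i : 'I_n) : R :=
  if i \in S then mu else 0.

Definition risk (d : measure_display) (T : measurableType d) (R : realType)
    (n : nat) (C : {set {set 'I_n}}) (P0 : probability T R)
    (P : {set 'I_n} -> probability T R)
    (X : {mfun T >-> n.-tuple R})
    (f : {mfun n.-tuple R >-> bool}) : \bar R :=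
  (P0 [set w | f (X w) = true] +
   (#|C|%:R^-1)%:E * \sum_(S in C) P S [set w | f (X w) = false])%E.

(* Main.v *)
Require Import Defs.
From HB Require Import structures.
From mathcomp Require Import all_boot all_order all_algebra.
From mathcomp Require Import all_classical all_reals all_analysis.
From mathcomp Require Import measurable_realfun ring lra.
Set Implicit Arguments.
Unset Strict Implicit.
Unset Printing Implicit Defensive.
Import Order.TTheory GRing.Theory Num.Theory.
Import numFieldNormedType.Exports.
Local Open Scope classical_set_scope.
Local Open Scope ring_scope.

(** Both error probabilities come from the Gaussian concentration inequality
    with its sharp constant: if [f] is [sqrt V]-Lipschitz for the Euclidean norm
    and [X] has independent unit-variance Gaussian coordinates, then
    [P (f X >= E f X + t) <= exp (- t^2 / (2 V))].  It is applied with [V = K]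
    to the maximum under P_0 and to [- x_S] under P_S; the threshold lies at the
    same distance [t = (mu K - E_0 max) / 2] from both means.

    Concentration is derived from the infimum-convolution (dual transport)
    inequality: if [h x <= f y + |x - y|^2 / 2] for all [x] and [y], then
    [E exp (h X) <= exp (E f X)].  This inequality tensorizes, by Fubini, since
    [f' y := E f (y, X')] and [h' y := ln (E exp (h (y, X')))] satisfy the
    one-dimensional hypothesis.  In dimension one it is proved by a monotone
    transport between truncated measures on a segment. *)

(** * The one-dimensional infimum-convolution inequality *)

Lemma derive_gt0_lt (R : realType) (a' : R) (F f : R -> R) :
  (forall x, a' < x -> is_derive x 1 F (f x)) ->
  (forall x, 0 < f x) ->
  {in `]a', +oo[ &, {homo F : x y / x < y}}.
Proof.
move=> dF f0 x y; rewrite !in_itv/= !andbT => ax ay xy.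
have dz z : z \in `]x, y[ -> is_derive z 1 F (f z).
  by rewrite in_itv/= => /andP[xz _]; apply: dF; exact: lt_trans xz.
have [|z zxy] := @MVT R F f x y xy dz.
  apply: derivable_within_continuous => z; rewrite in_itv/= => /andP[xz _].
  by have [] := dF z (lt_le_trans ax xz).
by move=> FE; rewrite -subr_gt0 FE mulr_gt0// subr_gt0.
Qed.

Lemma derive_ge0_le (R : realType) (a b : R) (J j : R -> R) : a <= b ->
  (forall x, a <= x <= b -> is_derive x 1 J (j x)) ->
  (forall x, a <= x <= b -> 0 <= j x) -> J a <= J b.
Proof.
rewrite le_eqVlt => /predU1P[->//|ab] dJ j0.
have [||z zxy] := @MVT R J j a b ab.
- by move=> z; rewrite in_itv/= => /andP[az zb]; apply: dJ; rewrite !ltW.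
- apply: derivable_within_continuous => z; rewrite in_itv/= => zab.
  by have [] := dJ z zab.
move: zxy; rewrite in_itv/= => /andP[az zb].
move=> JE; rewrite -subr_ge0 JE mulr_ge0 ?subr_ge0 ?(ltW ab)// j0//.
by rewrite !ltW.
Qed.

(** A positive derivative makes [G] injective to the right of [a'], so a choice of preimage is a
    left inverse there. The half-line is open so that every point has a neighbourhood on which this
    inverse works, as two-sided differentiation needs. *)
Lemma inverse_derive_gt0 (R : realType) (a' : R) (G q : R -> R) :
  (forall x, a' < x -> is_derive x 1 G (q x)) ->
  (forall x, 0 < q x) ->
  exists2 Ginv : R -> R, (forall x, a' < x -> Ginv (G x) = x) &
    forall x, a' < x -> is_derive (G x) 1 Ginv (q x)^-1.
Proof.
move=> dG q0.
have Ginj x y : a' < x -> a' < y -> G x = G y -> x = y.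
  move=> ax ay Gxy; have [xy|xy|//] := ltgtP x y.
  - by have := derive_gt0_lt dG q0 (x := x) (y := y);
      rewrite !in_itv/= ax ay Gxy ltxx => /(_ isT isT xy).
  - by have := derive_gt0_lt dG q0 (x := y) (y := x);
      rewrite !in_itv/= ax ay Gxy ltxx => /(_ isT isT xy).
pose Ginv u := get [set t | a' < t /\ G t = u].
have GK x : a' < x -> Ginv (G x) = x.
  move=> ax; rewrite /Ginv.
  have : [set t | a' < t /\ G t = G x] (get [set t | a' < t /\ G t = G x]).
    by apply: getPex; exists x.
  by move=> /= [aG GG]; exact: Ginj.
exists Ginv => // x ax.
apply: (is_derive_inverse _ _ (dG x ax)); last by rewrite gt_eqF.
- by near=> z; apply: GK; near: z; apply: lt_nbhsr.
- near=> z; have := dG z.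
  have az : a' < z by near: z; apply: lt_nbhsr.
  move=> /(_ az) [/derivable1_diffP/differentiable_continuous + _].
  exact.
Unshelve. all: by end_near. Qed.

(** The increments of [F], [G] and [A] over the segment are the integrals of [p], [expR h * p] and
    [g * p], so this is the logarithmic form of the inequality for the truncated measure.
    Antiderivatives replace a change of variables: the transport map is [G^-1] composed with an
    affine function of [F]. They live beyond some [a' < a], so that derivatives at [a] are
    two-sided. *)
Lemma gaussian_transport (R : realType) (m a' a b c : R) (h g F G A : R -> R) :
  let p x := c * expR (- ((x - m) ^+ 2 / 2)) in
  a' < a -> a < b -> 0 < c ->
  (forall x, a' < x -> is_derive x 1 F (p x)) ->
  (forall x, a' < x -> is_derive x 1 G (expR (h x) * p x)) ->
  (forall x, a' < x -> is_derive x 1 A (g x * p x)) ->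
  (forall x y, h x <= g y + (x - y) ^+ 2 / 2) ->
  (F b - F a) * ln ((G b - G a) / (F b - F a)) <= A b - A a.
Proof.
move=> p aa' ab c0 dF dG dA hg.
have p0 x : 0 < p x by rewrite mulr_gt0// expR_gt0.
have q0 x : 0 < expR (h x) * p x by rewrite mulr_gt0// expR_gt0.
have inI x : a' < x -> x \in `]a', +oo[ by move=> ?; rewrite in_itv/= andbT.
have ab' : a' < b by rewrite (lt_trans aa').
have Finc := derive_gt0_lt dF p0; have Ginc := derive_gt0_lt dG q0.
have dF0 : 0 < F b - F a by rewrite subr_gt0 Finc ?inI.
have dG0 : 0 < G b - G a by rewrite subr_gt0 Ginc ?inI.
have [Ginv GK dGinv] := inverse_derive_gt0 dG q0.
set r := (G b - G a) / (F b - F a).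
have r0 : 0 < r by rewrite divr_gt0.
(* The factor [r] equalizes the total masses: [U] climbs from [G a] to [G b] as [y] goes from [a] to
   [b]. *)
pose U y := G a + (F y - F a) * r.
have Gc x : a' < x -> {for x, continuous G}.
  by move=> /dG [/derivable1_diffP/differentiable_continuous].
have surj y : a <= y <= b -> exists2 t, a <= t <= b & G t = U y.
  move=> /andP[ay yb].
  have Fay : F a <= F y.
    move: ay; rewrite le_eqVlt => /predU1P[->//|ay].
    by rewrite ltW// Finc// inI// (lt_trans aa').
  have Fyb : F y <= F b.
    move: yb; rewrite le_eqVlt => /predU1P[->//|yb].
    by rewrite ltW// Finc// inI// (lt_le_trans aa').
  have [||t] := @IVT _ G a b (U y) (ltW ab).
  - apply: continuous_in_subspaceT => x; rewrite inE/= in_itv/= => /andP[ax _].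
    by apply: Gc; rewrite (lt_le_trans aa').
  - have GE : G b = G a + (F b - F a) * r by rewrite /r mulrC divfK ?gt_eqF// subrKC.
    have Gab : G a <= G b by rewrite -subr_ge0 ltW.
    rewrite (min_idPl Gab) (max_idPr Gab) GE /U.
    by rewrite lerDl mulr_ge0 ?subr_ge0 ?(ltW r0)//= lerD2l ler_pM2r// lerD2r.
  - by rewrite in_itv/=; exists t.
pose T y := Ginv (U y).
have TP y : a <= y <= b -> a <= T y <= b /\ G (T y) = U y.
  move=> /surj[t tab Gt]; rewrite /T -Gt GK//.
  by case/andP: tab => at_ _; rewrite (lt_le_trans aa').
have Ta : T a = a by rewrite /T /U subrr mul0r addr0 GK.
have Tb : T b = b.
  by rewrite /T /U /r mulrC divfK ?gt_eqF// subrKC GK.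
(* This value comes from differentiating [G (T y) = U y]. *)
pose T' y := p y * r / (expR (h (T y)) * p (T y)).
have dT y : a <= y <= b -> is_derive y 1 T (T' y).
  move=> yab; have [/andP[aT Tb'] GT] := TP y yab.
  have dU : is_derive y 1 U (p y * r).
    have ay : a' < y by exact: lt_le_trans aa' (proj1 (andP yab)).
    have dFy := dF y ay.
    rewrite /U; apply: is_derive_eq.
    rewrite /GRing.scale/=; ring.
  have dI := dGinv (T y) (lt_le_trans aa' aT).
  rewrite GT in dI.
  have := is_derive1_comp dI dU => dTy.
  by apply: is_derive_eq; rewrite mulrC.
have dp (y : R) : is_derive y 1 p (- (y - m) * p y).
  rewrite /p; apply: is_derive_eq.
  by rewrite /GRing.scale/=; field.
(* T transports p onto the normalization of expR h * p.  As T fixes a and b, the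
   first summand of J vanishes there, so J a <= J b is the claim; J' >= 0 follows
   from ln T' <= T' - 1. *)
pose L := ln r.
pose J y := (T y - y) * p y + A y - L * F y.
pose j y := (T' y - 1) * p y + (T y - y) * (- (y - m) * p y) + g y * p y - L * p y.
have JE : J a <= J b.
  apply: (@derive_ge0_le _ _ _ _ j (ltW ab)) => y yab.
    have dTy := dT y yab; have dpy := dp y.
    have ay : a' < y by exact: lt_le_trans aa' (proj1 (andP yab)).
    have dFy := dF y ay; have dAy := dA y ay.
    rewrite /J; apply: is_derive_eq.
    rewrite /j /GRing.scale/=; ring.
  have T'0 : 0 < T' y by rewrite divr_gt0// mulr_gt0.
  have -> : j y = p y * (T' y - 1 - (T y - y) * (y - m) + g y - L) by rewrite /j; ring.
  rewrite mulr_ge0 ?(ltW (p0 y))//.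
  (* This is the logarithm of the transport equation [T' y * (expR (h (T y)) * p (T y)) = p y * r].
     Expanding the Gaussian logarithms turns the bracket into [T' y - 1 - ln (T' y) + g y - h (T y)
     + (T y - y) ^+ 2 / 2]. *)
  have -> : L = ln (T' y) + h (T y) + ln (p (T y)) - ln (p y).
    rewrite /L; have -> : r = T' y * (expR (h (T y)) * p (T y)) / p y.
      by rewrite /T'; field; rewrite !gt_eqF ?expR_gt0.
    rewrite ln_div ?posrE ?(mulr_gt0 T'0 (q0 _))//.
    by rewrite (lnM T'0 (q0 _)) (lnM (expR_gt0 _) (p0 _)) expRK addrA.
  have lnp x : ln (p x) = ln c - (x - m) ^+ 2 / 2.
    by rewrite /p lnM ?posrE ?expR_gt0// expRK.
  rewrite !lnp.
  have h1 : ln (T' y) <= T' y - 1.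
    by rewrite -{1}(subrKC 1 (T' y)) le_ln1Dx// ltrBrDl subrr.
  have h2 := hg (T y) y.
  lra.
rewrite /J Ta Tb !subrr !mul0r !add0r in JE.
rewrite -/L; lra.
Qed.

(** * Integration against the normal density, and truncation to segments *)

Lemma ge0_integral_normal_prob (R : realType) (m s : R) (f : R -> \bar R)
    (U : set R) :
  (forall x, (0 <= f x)%E) -> measurable U -> measurable_fun U f ->
  (\int[normal_prob m s]_(x in U) f x =
   \int[lebesgue_measure]_(x in U) (f x * (normal_pdf m s x)%:E))%E.
Proof.
move=> f0 mU mf.
have dom := normal_prob_dominates m s.
rewrite -(Radon_Nikodym_SigmaFinite.change_of_variables dom)//=.
have mpdf : measurable_fun setT (fun x => (normal_pdf m s x)%:E).
  by apply/measurable_EFinP; exact: measurable_normal_pdf.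
apply: ae_eq_integral => //.
- apply: emeasurable_funM => //; apply: measurable_funTS.
  exact: measurable_int (Radon_Nikodym_SigmaFinite.f_integrable dom).
- by apply: emeasurable_funM => //; exact: measurable_funTS.
(* The Radon-Nikodym derivative and the density have equal integrals over every measurable set,
   hence agree almost everywhere. *)
apply: ae_eqe_mul2l; apply: integral_ae_eq => //.
- exact: integrableS (Radon_Nikodym_SigmaFinite.f_integrable dom).
- exact: measurable_funTS.
- by move=> E EU mE; rewrite -Radon_Nikodym_SigmaFinite.f_integral.
Qed.

Lemma integral_normal_prob (R : realType) (m s : R) (f : R -> \bar R) (U : set R) :
  measurable U -> measurable_fun U f ->
  (\int[normal_prob m s]_(x in U) f x =
   \int[lebesgue_measure]_(x in U) (f x * (normal_pdf m s x)%:E))%E.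
Proof.
move=> mU mf; rewrite integralE [RHS]integralE.
rewrite !ge0_integral_normal_prob//; last 2 first.
- exact: measurable_funeneg.
- exact: measurable_funepos.
congr (_ - _)%E; apply: eq_integral => x _.
- by rewrite !funeposE maxe_pMl ?mul0e// lee_fin normal_pdf_ge0.
- by rewrite !funenegE -mulNe maxe_pMl ?mul0e// lee_fin normal_pdf_ge0.
Qed.

Lemma continuous_antiderivative (R : realType) (a' : R) (f : R -> R) :
  continuous f ->
  exists2 F : R -> R, (forall x, a' < x -> is_derive x 1 F (f x)) &
    forall a b, a' < a -> a <= b ->
      F b - F a = \int[lebesgue_measure]_(x in `[a, b]) f x.
Proof.
move=> cf.
have intf a b : lebesgue_measure.-integrable `[a, b] (EFin \o f).
  apply: continuous_compact_integrable; first exact: segment_compact.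
  exact: continuous_subspaceT.
exists (fun x => \int[lebesgue_measure]_(t in `[a', x]) f t).
  move=> x ax.
  have [] := @continuous_FTC1_closed R f a' x (x + 1) _ (intf _ _) ax (cf x).
    by rewrite ltrDl.
  by move=> d E; rewrite -E derive1E; exact: derivableP.
move=> a b aa' ab.
rewrite Rintegral_itvB//.
  rewrite Rintegral_itv_obnd_cbnd//.
  by apply: integrableS (intf a b) => //; apply: subset_itv; rewrite bnd_simp.
by rewrite bnd_simp ltW.
Qed.

Lemma continuous_segment_integrable (R : realType)
    (P : probability (measurableTypeR R) R) (a b : R) (f : R -> R) :
  continuous f -> P.-integrable `[a, b] (EFin \o f).
Proof.
move=> cf; apply: measurable_bounded_integrable => //.
- by rewrite (le_lt_trans (probability_le1 _ _))// ltry.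
- by apply: measurable_funTS; exact: continuous_measurable_fun.
- have cf' : {within `[a, b], continuous f} by exact: continuous_subspaceT.
  have [M [_ Mf]] := compact_bounded (continuous_compact cf' (@segment_compact R a b)).
  by exists M; split; rewrite ?num_real // => x Mx y ?; exact: Mf.
Qed.

(** The restricted law has mass [m], not 1, hence the normalization by [m]. Exponentiating the
    conclusion of [gaussian_transport] gives the bound. *)
Lemma gaussian_infconv_segment (R : realType) (mean a b : R) (h g : R -> R) :
  a < b -> continuous h -> continuous g ->
  (forall x y, h x <= g y + (x - y) ^+ 2 / 2) ->
  let m := fine (normal_prob mean 1 `[a, b]) in
  0 < m /\
  \int[normal_prob mean 1]_(x in `[a, b]) expR (h x) <=
  m * expR ((\int[normal_prob mean 1]_(x in `[a, b]) g x) / m).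
Proof.
move=> ab ch cg hg m.
pose p (x : R) := normal_peak 1 * expR (- ((x - mean) ^+ 2 / 2)).
have pE x : normal_pdf mean 1 x = p x.
  by rewrite normal_pdfE ?oner_neq0// /normal_fun expr1n mulNr.
have cp : continuous p.
  have -> : p = normal_pdf mean 1 by apply/funext => x; rewrite pE.
  by apply: continuous_normal_pdf; rewrite oner_neq0.
have RE f : continuous f -> \int[normal_prob mean 1]_(x in `[a, b]) f x =
    \int[lebesgue_measure]_(x in `[a, b]) (f x * p x).
  move=> cf; rewrite /Rintegral integral_normal_prob//=.
    by under eq_integral do rewrite -EFinM pE.
  by have /measurable_EFinP := continuous_measurable_fun cf; exact: measurable_funTS.
have mE : m = \int[normal_prob mean 1]_(x in `[a, b]) 1 :> R.
  by rewrite Rintegral_cst// mul1r.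
(* Any base point left of [a] would do; it makes the antiderivatives differentiable at [a]
   itself. *)
have [F dF FE] := continuous_antiderivative (a - 1) cp.
have cep : continuous (fun x => expR (h x) * p x).
  move=> x; apply: cvgM; last exact: cp.
  by apply: continuous_comp; [exact: ch|exact: continuous_expR].
have cgp : continuous (fun x => g x * p x).
  by move=> x; apply: cvgM; [exact: cg|exact: cp].
have [G dG GE] := continuous_antiderivative (a - 1) cep.
have [A dA AE] := continuous_antiderivative (a - 1) cgp.
have aa : a - 1 < a by rewrite ltrBlDr ltrDl.
have peak0 : 0 < normal_peak 1 :> R by rewrite normal_peak_gt0// oner_neq0.
have ceh : continuous (fun x => expR (h x)).
  by move=> x; apply: continuous_comp; [exact: ch|exact: continuous_expR].
have FbE : F b - F a = m.
  rewrite FE ?(ltW ab)// mE RE; last by move=> x; exact: cvg_cst.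
  by apply: eq_Rintegral => x _; rewrite mul1r.
have p0 x : 0 < p x by rewrite mulr_gt0// expR_gt0.
have q0 x : 0 < expR (h x) * p x by rewrite mulr_gt0// expR_gt0.
have aI : a \in `]a - 1, +oo[ by rewrite in_itv/= andbT.
have bI : b \in `]a - 1, +oo[ by rewrite in_itv/= andbT (lt_trans aa).
have m0 : 0 < m by rewrite -FbE subr_gt0 (derive_gt0_lt dF).
have G0 : 0 < G b - G a by rewrite subr_gt0 (derive_gt0_lt dG).
split=> //; rewrite !RE// -(GE _ _ aa (ltW ab)) -(AE _ _ aa (ltW ab)).
have := gaussian_transport aa ab peak0 dF dG dA hg.
rewrite FbE mulrC -ler_pdivlMr// -ler_expR lnK ?posrE ?divr_gt0//.
by rewrite ler_pdivrMr// mulrC.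
Qed.

(** The radius [n.+1] keeps the segment nondegenerate at [n = 0]. Symmetry about [c] serves the
    computation of the normal mean. *)
Definition centered_itv (R : realType) (c : R) (n : nat) : set (measurableTypeR R) :=
  `[c - n.+1%:R, c + n.+1%:R]%classic.

Lemma mem_centered_itv (R : realType) (c x : R) (n : nat) :
  (Num.truncn `|x - c|%R <= n)%N -> centered_itv c n x.
Proof.
rewrite truncn_le_nat => xn.
by rewrite /centered_itv/= in_itv/= -ler_distl ltW.
Qed.

Lemma nondecreasing_centered_itv (R : realType) (c : R) :
  nondecreasing_seq (centered_itv c).
Proof.
move=> i j ij; apply/subsetPset; apply: subset_itv.
- by rewrite bnd_simp lerD2l lerN2 ler_nat.
- by rewrite bnd_simp lerD2l ler_nat.
Qed.

Lemma bigcup_centered_itv (R : realType) (c : R) :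
  \bigcup_n centered_itv c n = setT.
Proof.
by rewrite -subTset => x _; exists (Num.truncn `|x - c|) => //; exact: mem_centered_itv.
Qed.

(** Dominated convergence: the truncations of [g] are bounded by its absolute value and are
    eventually constant at each point. *)
Lemma cvg_Rintegral_centered_itv (R : realType)
    (P : probability (measurableTypeR R) R) (c : R) (g : R -> R) :
  P.-integrable setT (EFin \o g) ->
  \int[P]_(x in centered_itv c n) g x @[n --> \oo] --> \int[P]_x g x.
Proof.
move=> ig; apply: fine_cvg; rewrite fineK; last exact: integrable_fin_num.
pose u (n : nat) : measurableTypeR R -> \bar R := (EFin \o g) \_ (centered_itv c n).
have mg := measurable_int _ ig.
have [|||||_ _ +] := @dominated_convergence _ _ _ P setT measurableT
  u (EFin \o g) (abse \o EFin \o g).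
- move=> n; have mI : measurable (centered_itv c n) by exact: measurable_itv.
  exact: (@measurable_restrictT _ _ _ _ _ (EFin \o g) mI).1 (measurable_funTS mg).
- exact: mg.
- apply/aeW => x _; apply: cvg_near_cst.
  exists (Num.truncn `|x - c|) => // n /= xn.
  by rewrite /u patchE mem_set//; exact: mem_centered_itv.
- exact: integrable_abse.
- by apply/aeW => x n _ /=; rewrite /u patchE; case: ifP => // _; rewrite abse0.
apply: cvg_trans; apply: near_eq_cvg; apply: nearW => k.
by rewrite [RHS]integral_mkcond.
Qed.

(** The segment inequality passes to the limit over growing segments. The left side converges
    monotonically, so [expR h] need not be known integrable; the right side converges because the
    masses [w n] tend to 1 and [g] is integrable. *)
Lemma gaussian_infconv (R : realType) (m : R) (h g : R -> R) :
  continuous h -> continuous g ->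
  (normal_prob m 1).-integrable setT (EFin \o g) ->
  (forall x y, h x <= g y + (x - y) ^+ 2 / 2) ->
  (\int[normal_prob m 1]_x (expR (h x))%:E <=
   (expR (\int[normal_prob m 1]_x g x))%:E)%E.
Proof.
move=> ch cg ig hg.
pose I := centered_itv m.
have mI n : measurable (I n) by exact: measurable_itv.
have UI : \bigcup_n I n = setT by exact: bigcup_centered_itv.
have mh : measurable_fun setT (fun x => (expR (h x))%:E).
  apply/measurable_EFinP; apply: measurableT_comp => //.
  exact: continuous_measurable_fun.
have cvZ : (\int[normal_prob m 1]_(x in I n) (expR (h x))%:E @[n --> \oo] -->
    \int[normal_prob m 1]_x (expR (h x))%:E)%E.
  rewrite -UI; apply: ge0_nondecreasing_set_cvg_integral => //.
    exact: nondecreasing_centered_itv.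
  by move=> i; exact: measurable_funTS.
pose w n : R := fine (normal_prob m 1 (I n)).
have cvw : w n @[n --> \oo] --> (1 : R).
  apply: fine_cvg.
  rewrite -[X in _ --> X](@probability_setT _ _ R (normal_prob m 1)) -UI.
  apply: nondecreasing_cvg_mu => //; first by rewrite UI.
  exact: nondecreasing_centered_itv.
have cvA := cvg_Rintegral_centered_itv m ig.
have ab n : m - n.+1%:R < m + n.+1%:R by rewrite ltrD2l (@lt_trans _ _ 0)// oppr_lt0.
have H n := gaussian_infconv_segment m (ab n) ch cg hg.
pose r n := w n * expR ((\int[normal_prob m 1]_(x in I n) g x) / w n).
have cvr : (r n)%:E @[n --> \oo] --> (expR (\int[normal_prob m 1]_x g x))%:E.
  apply: cvg_EFin; first exact: nearW.
  rewrite /r -[X in _ --> X]mul1r -[X in expR X]divr1.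
  apply: cvgM => //; apply: continuous_cvg; first exact: continuous_expR.
  by apply: cvgM => //; apply: cvgV.
rewrite -(cvg_lim _ cvZ)// -(cvg_lim _ cvr)//.
apply: lee_lim.
- by apply: cvgP cvZ.
- by apply: cvgP cvr.
apply: nearW => n /=.
have [_] := H n; rewrite -lee_fin; apply: le_trans.
rewrite /Rintegral fineK//; apply: integrable_fin_num => //.
apply: (@continuous_segment_integrable _ _ _ _ (fun x => expR (h x))).
by move=> x; apply: continuous_comp; [exact: ch|exact: continuous_expR].
Qed.

(** * Integrability and mean of the normal law *)

Lemma expR_normal_pdf (R : realType) (m t x : R) :
  expR (t * (x - m)) * normal_pdf m 1 x =
  expR (t ^+ 2 / 2) * normal_pdf (m + t) 1 x.
Proof.
(* Completing the square: exponential tilting translates the Gaussian density by [t]. *)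
rewrite !normal_pdfE ?oner_neq0// mulrCA [RHS]mulrCA; congr (_ * _).
by rewrite /normal_fun expr1n -!expRD; congr expR; field.
Qed.

(** The identity is dominated by [expR (x - m) + expR (- (x - m))] plus the constant [|m|], and both
    exponentials are integrable by tilting. *)
Lemma normal_prob_integrable_id (R : realType) (m : R) :
  (normal_prob m 1).-integrable setT (EFin \o (@idfun R)).
Proof.
have mexp (t : R) : measurable_fun setT (fun x : R => (expR (t * (x - m)))%:E).
  apply/measurable_EFinP; apply: measurableT_comp => //.
  by apply: measurable_funM => //; exact: measurable_funB.
have ie (t : R) : (\int[normal_prob m 1]_x (expR (t * (x - m)))%:E < +oo)%E.
  rewrite (ge0_integral_normal_prob _ _ _ _ (mexp t))//.
  under eq_integral do rewrite -EFinM expR_normal_pdf EFinM.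
  rewrite integralZl//; last exact: integrable_normal_pdf.
  by rewrite integral_normal_pdf mule1 ltry.
have ie' (t : R) :
    (normal_prob m 1).-integrable setT (fun x => (expR (t * (x - m)))%:E).
  apply/integrableP; split; first exact: mexp.
  by under eq_integral do rewrite /= ger0_norm ?expR_ge0//; exact: ie.
apply: (@le_integrable _ _ _ _ _ measurableT _
  (fun x : measurableTypeR R =>
    (expR (1 * (x - m)))%:E + (expR (-1 * (x - m)))%:E + `|m|%:E)%E).
- by have /measurable_EFinP := @measurable_id _ (measurableTypeR R) setT.
- move=> x _; rewrite -!EFinD lee_fin [leRHS]ger0_norm; last first.
    by rewrite !addr_ge0// expR_ge0.
  have := expR_ge1Dx (x - m); have := expR_ge1Dx (- (x - m)).
  have := expR_ge0 (x - m); have := expR_ge0 (- (x - m)).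
  rewrite mul1r mulN1r; have := ler_normD (x - m) m; rewrite subrK.
  by case: (ger0P (x - m)) => _; case: (ger0P m) => _; lra.
apply: integrableD => //; first by apply: integrableD; first by []; exact: ie'.
by apply: finite_measure_integrable_cst.
Qed.

(** The density [p] satisfies [(- p)' = (x - m) * p] and takes equal values at the ends of a segment
    centred at [m]. Every truncated integral of [x - m] therefore vanishes, and so does the
    limit. *)
Lemma normal_prob_mean (R : realType) (m : R) : \int[normal_prob m 1]_x x = m.
Proof.
have ix := normal_prob_integrable_id m.
have im : (normal_prob m 1).-integrable setT (EFin \o (cst m)).
  exact: finite_measure_integrable_cst.
have ixm : (normal_prob m 1).-integrable setT (EFin \o (fun x => x - m)).
  rewrite (_ : _ \o _ = (EFin \o @idfun R) \- (EFin \o cst m))%E//.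
  exact: integrableB.
suff xm0 : \int[normal_prob m 1]_x (x - m) = 0.
  move: xm0; rewrite RintegralB// Rintegral_cst//.
  rewrite [X in fine X](@probability_setT _ _ R (normal_prob m 1)) /= mulr1.
  by move/eqP; rewrite subr_eq0 => /eqP.
have := cvg_Rintegral_centered_itv m ixm.
rewrite (_ : (fun n => _) = cst 0).
  by move/cvg_lim => <-//; rewrite lim_cst.
apply/funext => n.
pose p (x : R) := normal_peak 1 * expR (- ((x - m) ^+ 2 / 2)).
have pE x : normal_pdf m 1 x = p x.
  by rewrite normal_pdfE ?oner_neq0// /normal_fun expr1n mulNr.
have dp (x : R) : is_derive x 1 (fun y => - p y) ((x - m) * p x).
  rewrite /p; apply: is_derive_eq.
  by rewrite /GRing.scale/=; field.
have cp : continuous p.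
  have -> : p = normal_pdf m 1 by apply/funext => x; rewrite pE.
  by apply: continuous_normal_pdf; rewrite oner_neq0.
have cNp : continuous (fun y => - p y) by move=> x; apply: cvgN; exact: cp.
rewrite /Rintegral integral_normal_prob//=; last 2 first.
- exact: measurable_itv.
- by apply: measurable_funTS; exact: measurable_int ixm.
under eq_integral do rewrite pE -EFinM.
rewrite (@continuous_FTC2 _ (fun x => (x - m) * p x) (fun y => - p y))//=.
- by rewrite opprK /p; rewrite addrAC subrr add0r addrAC subrr add0r sqrrN addNr.
- by rewrite ltrD2l (@lt_trans _ _ 0)// oppr_lt0.
- apply: continuous_subspaceT => x; apply: cvgM; last exact: cp.
  by apply: cvgB; [exact: cvg_id|exact: cvg_cst].
- split; first by move=> x _; have [] := dp x.
  + exact/cvg_at_right_filter/cNp.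
  + exact/cvg_at_left_filter/cNp.
- by move=> x _; rewrite derive1E; have [_ ->] := dp x.
Qed.

(** * Independence of the first coordinate and the remaining ones *)

Definition box (R : realType) n (B : 'I_n -> set R) : set (n.-tuple R) :=
  [set x | forall i, B i (tnth x i)].

(** Boxes are stable under intersection, unlike the coordinate preimages that generate the product
    sigma-algebra; uniqueness of measures needs such a generator. *)
Lemma measurable_tuple_box (R : realType) n :
  @measurable _ (n.-tuple R) =
  <<s [set Z | exists2 B : 'I_n -> set R, (forall i, measurable (B i)) & Z = box B] >>.
Proof.
apply/seteqP; split.
  apply: smallest_sub; first exact: smallest_sigma_algebra.
  case: n => [|n]; first by rewrite big_ord0.
  rewrite -bigcup_mkord_ord => A [i _ [B mB <-]].
  apply: sub_sigma_algebra.
  exists (fun j => if j == inord i then B else setT).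
    by move=> j; case: ifP.
  apply/seteqP; split => x /=; rewrite ?setTI /box/=.
    by move=> [_ Bx] j; have [->|_] := eqVneq j (inord i).
  by move=> /(_ (inord i)); rewrite eqxx.
apply: smallest_sub; first exact: sigma_algebra_measurable.
move=> _ [B mB ->].
have -> : box B = \bigcap_(i in [set: 'I_n]) ((fun x => tnth x i) @^-1` B i).
  by apply/seteqP; split=> x /= Bx => [i _|i]; [exact: Bx|exact: (Bx i I)].
apply: fin_bigcap_measurable => // i _.
rewrite -[X in measurable X]setTI; exact: measurable_tnth.
Qed.

Section head_behead.
Context (d : measure_display) (T : measurableType d) (R : realType) (n : nat).
Variable X : {mfun T >-> n.+1.-tuple R}.

(* [measurableTypeR R], the type carrying [normal_prob], has the measurable sets
   of [R] but another display, so that measures on both types do not unify. *)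
Definition tuple_head_mfun (w : T) : measurableTypeR R := thead (X w).
Definition tuple_behead_mfun (w : T) : n.-tuple R := [tuple of behead (X w)].

Lemma measurable_tuple_head_mfun : measurable_fun setT tuple_head_mfun.
Proof. by apply: measurableT_comp => //; exact: measurable_tnth. Qed.

Lemma measurable_tuple_behead_mfun : measurable_fun setT tuple_behead_mfun.
Proof. by apply: (measurableT_comp (@measurable_behead _ _ n)). Qed.

HB.instance Definition _ :=
  isMeasurableFun.Build _ _ _ _ tuple_head_mfun measurable_tuple_head_mfun.
HB.instance Definition _ :=
  isMeasurableFun.Build _ _ _ _ tuple_behead_mfun measurable_tuple_behead_mfun.

End head_behead.

Section independence.
Context (d : measure_display) (T : measurableType d) (R : realType).
Variable P : probability T R.

Lemma mutually_independent_box (n : nat) (X : T -> n.-tuple R) (B : 'I_n -> set R) :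
  mutually_independent P (fun i w => tnth (X w) i) ->
  (forall i, measurable (B i)) ->
  P (X @^-1` box B) = (\prod_i P ((fun w => tnth (X w) i) @^-1` B i))%E.
Proof.
move=> indX mB; have := indX [set: 'I_n]%SET B (fun i _ => mB i).
under [in RHS]eq_bigl do rewrite inE.
move=> <-; congr (P _); apply/seteqP; split => w /=.
  by move=> Bw i _; exact: Bw.
by move=> Bw i; apply: Bw => /=; rewrite inE.
Qed.

Lemma tnth_behead_mfun (n : nat) (X : {mfun T >-> n.+1.-tuple R}) w i :
  tnth (tuple_behead_mfun X w) i = tnth (X w) (lift ord0 i).
Proof.
rewrite tnth_behead; congr tnth; apply: val_inj => /=.
by rewrite inordK ?ltnS ?ltn_ord// /bump leq0n.
Qed.

Lemma mutually_independent_behead (n : nat) (X : {mfun T >-> n.+1.-tuple R}) :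
  mutually_independent P (fun i w => tnth (X w) i) ->
  mutually_independent P (fun i w => tnth (tuple_behead_mfun X w) i).
Proof.
move=> indX J B mB.
(* Index sets of the tail are shifted past [ord0]; the value [setT] only makes the family total. *)
pose B' (i : 'I_n.+1) := if unlift ord0 i is Some j then B j else setT.
have B'E j : B' (lift ord0 j) = B j by rewrite /B' liftK.
have := indX (lift ord0 @: J)%SET B'.
rewrite (big_imset _ (in2W (@lift_inj _ ord0)))/=.
under eq_bigr do rewrite B'E.
have -> : \bigcap_(i in [set` J])
     ((fun w => tnth (tuple_behead_mfun X w) i) @^-1` B i) =
   \bigcap_(i in [set` (lift ord0 @: J)%SET]) ((fun w => tnth (X w) i) @^-1` B' i).
  apply/seteqP; split => w /= Bw i /=.
    by move=> /imsetP[j jJ ->]; rewrite B'E -tnth_behead_mfun; exact: Bw.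
  by move=> iJ; rewrite tnth_behead_mfun -B'E; apply: Bw; exact: imset_f.
move=> ->.
  apply: eq_bigr => i _; congr (P _); apply/seteqP.
  by split => w; rewrite /preimage/= tnth_behead_mfun.
by move=> _ /imsetP[j jJ ->]; rewrite B'E; exact: mB.
Qed.

Lemma indep_normal_behead (n : nat) (X : {mfun T >-> n.+1.-tuple R})
    (m : 'I_n.+1 -> R) :
  indep_normal P X m ->
  indep_normal P (tuple_behead_mfun X) (fun i => m (lift ord0 i)).
Proof.
move=> [indX lawX]; split; first exact: mutually_independent_behead.
move=> i B mB; rewrite -lawX//; congr (P _); apply/seteqP.
by split => w; rewrite /preimage/= tnth_behead_mfun.
Qed.

(** For fixed [A], both sides are finite measures in [B]. They agree on boxes by mutual
    independence, hence everywhere. *)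
Lemma indep_head_behead (n : nat) (X : {mfun T >-> n.+1.-tuple R}) :
  mutually_independent P (fun i w => tnth (X w) i) ->
  forall (A : set (measurableTypeR R)) (B : set (n.-tuple R)),
  measurable A -> measurable B ->
  P (tuple_head_mfun X @^-1` A `&` tuple_behead_mfun X @^-1` B) =
  (distribution P (tuple_head_mfun X) A * distribution P (tuple_behead_mfun X) B)%E.
Proof.
move=> indX A B mA mB.
have mA' : measurable (tuple_head_mfun X @^-1` A).
  by rewrite -[X in measurable X]setTI; exact: measurable_tuple_head_mfun.
pose r : {nonneg R} := NngNum (fine_ge0 (measure_ge0 P (tuple_head_mfun X @^-1` A))).
suff : pushforward (mrestr P mA') (tuple_behead_mfun X) B =
       mscale r (distribution P (tuple_behead_mfun X)) B.
  rewrite /mscale /pushforward /mrestr /= setIC => ->.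
  by rewrite fineK ?fin_num_measure.
pose G := [set Z | exists2 B : 'I_n -> set R, (forall i, measurable (B i)) & Z = box B].
apply: (measure_unique G (fun=> setT)) => //.
- exact: measurable_tuple_box.
- move=> _ _ [B1 mB1 ->] [B2 mB2 ->]; exists (fun i => B1 i `&` B2 i).
    by move=> i; exact: measurableI.
  apply/seteqP; split=> x /=; first by move=> [? ?] i; split.
  by move=> h; split=> i; have [] := h i.
- move=> _; exists (fun=> setT) => //; apply/seteqP; split => //.
- by rewrite bigcup_const//; exists 0%N.
- move=> _ [C mC ->].
  rewrite -[LHS]/(P (tuple_behead_mfun X @^-1` box C `&` tuple_head_mfun X @^-1` A)).
  rewrite -[RHS]/((fine (P (tuple_head_mfun X @^-1` A)))%:E *
                  P (tuple_behead_mfun X @^-1` box C))%E fineK ?fin_num_measure//.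
  rewrite (mutually_independent_box (mutually_independent_behead indX) mC).
  (* Prepending [A] to the sides of the box turns the intersection into the preimage of a single box
     in dimension [n.+1]. *)
  pose C' (i : 'I_n.+1) := if unlift ord0 i is Some j then C j else A.
  have mC' i : measurable (C' i) by rewrite /C'; case: unliftP.
  have C'E j : C' (lift ord0 j) = C j by rewrite /C' liftK.
  have C'0 : C' ord0 = A by rewrite /C' unlift_none.
  have := mutually_independent_box indX mC'.
  rewrite big_ord_recl C'0; under eq_bigr do rewrite C'E.
  rewrite (_ : X @^-1` box C' =
      tuple_behead_mfun X @^-1` box C `&` tuple_head_mfun X @^-1` A).
    move=> ->; congr (_ * _)%E; apply: eq_bigr => i _; congr (P _); apply/seteqP.
    by split => w; rewrite /preimage/= tnth_behead_mfun.
  apply/seteqP; split => w /=.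
    move=> Cw; split; last by rewrite /tuple_head_mfun -C'0; exact: Cw.
    by move=> i; rewrite tnth_behead_mfun -C'E; exact: Cw.
  move=> [Cw Aw] i; case: (unliftP ord0 i) => [j ->|->]; last by rewrite C'0.
  by rewrite C'E -tnth_behead_mfun; exact: Cw.
- move=> _.
  rewrite -[ltLHS]/(P (tuple_behead_mfun X @^-1` setT `&` tuple_head_mfun X @^-1` A)).
  by rewrite preimage_setT setTI (le_lt_trans (probability_le1 _ _))// ltry.
Qed.

End independence.

(** * Fubini for the head and the tail of an independent vector *)

Section fubini_head_behead.
Context (d : measure_display) (T : measurableType d) (R : realType) (n : nat).
Variables (P : probability T R) (X : {mfun T >-> n.+1.-tuple R}).
Hypothesis indX : mutually_independent P (fun i w => tnth (X w) i).
Local Notation H := (distribution P (tuple_head_mfun X)).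
Local Notation B := (distribution P (tuple_behead_mfun X)).

Definition head_behead_pair (w : T) : measurableTypeR R * n.-tuple R :=
  (tuple_head_mfun X w, tuple_behead_mfun X w).

Lemma measurable_head_behead_pair : measurable_fun setT head_behead_pair.
Proof. exact: measurable_fun_pair. Qed.

Lemma head_behead_product_law (A : set (measurableTypeR R * n.-tuple R)) :
  measurable A ->
  (H \x B)%E A = pushforward P head_behead_pair A.
Proof.
move=> mA.
have mp := measurable_head_behead_pair.
apply: (@product_measure_unique _ _ _ _ R H B) => // C D mC mD.
rewrite -(indep_head_behead indX mC mD).
by [].
Qed.

Variable F : measurableTypeR R * n.-tuple R -> \bar R.
Hypothesis mF : measurable_fun setT F.

(** The inner integral stays over [P], with the tail as a random vector on [T]: this is the form to
    which the induction hypothesis on the dimension applies. *)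
Lemma ge0_integral_head_behead : (forall z, (0 <= F z)%E) ->
  (\int[P]_w F (head_behead_pair w) =
   \int[H]_y \int[P]_w F (y, tuple_behead_mfun X w))%E.
Proof.
move=> F0.
have mp := measurable_head_behead_pair.
rewrite -[LHS](ge0_integral_pushforward mp P measurableT)//.
rewrite (eq_measure_integral (H \x B)%E); last first.
  by move=> A mA _; apply/esym; exact: head_behead_product_law.
rewrite fubini_tonelli1//; apply: eq_integral => y _.
rewrite /fubini_F ge0_integral_distribution//.
exact: measurableT_comp.
Qed.

Hypothesis iF : P.-integrable setT (F \o head_behead_pair).

Lemma integral_head_behead :
  (\int[P]_w F (head_behead_pair w) =
   \int[H]_y \int[B]_x F (y, x))%E /\
  H.-integrable setT (fun y => \int[B]_x F (y, x))%E.
Proof.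
have mp := measurable_head_behead_pair.
have iF' : (H \x B)%E.-integrable setT F.
  have /integrableP[_ Foo] := integrable_pushforward mp mF iF measurableT.
  apply/integrableP; split=> //; move: Foo.
  rewrite (eq_measure_integral (H \x B)%E)// => A mA _.
  by apply/esym; exact: head_behead_product_law.
split; last exact: (integrable_fubini_F iF').
rewrite -[LHS](integral_pushforward mp mF iF measurableT).
rewrite (eq_measure_integral (H \x B)%E); last first.
  by move=> A mA _; apply/esym; exact: head_behead_product_law.
by rewrite -integral12_prod_meas1.
Qed.

End fubini_head_behead.

(** * Integrability of normal coordinates and of Lipschitz functions of them *)

Section normal_law.
Context (d : measure_display) (T : measurableType d) (R : realType).
Variables (P : probability T R).

Lemma integral_normal_law (Y : {mfun T >-> measurableTypeR R}) (m : R) :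
  (forall B, measurable B -> P (Y @^-1` B) = normal_prob m 1 B) ->
  P.-integrable setT (EFin \o Y) /\ \int[P]_w Y w = m.
Proof.
move=> lawY.
have mid : measurable_fun setT (EFin : measurableTypeR R -> \bar R).
  by have /measurable_EFinP := @measurable_id _ (measurableTypeR R) setT.
have iY : P.-integrable setT (EFin \o Y).
  apply/integrableP; split; first exact: measurableT_comp mid _.
  have /integrableP[_ Hoo] := normal_prob_integrable_id m.
  have mabs : measurable_fun setT (fun y : measurableTypeR R => `|y%:E|)%E.
    exact: measurableT_comp.
  have := @ge0_integral_distribution _ _ _ _ _ P Y (fun y => `|y%:E|)%E mabs
    (fun=> abse_ge0 _).
  move=> <-; rewrite (eq_measure_integral (normal_prob m 1))// => A mA _.
  exact: lawY.
split => //; rewrite -[RHS](normal_prob_mean m) /Rintegral; congr fine.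
rewrite -[LHS](@integral_distribution _ _ _ _ _ P Y (fun y => y%:E))//.
by apply: eq_measure_integral => A mA _; exact: lawY.
Qed.

End normal_law.

Section lipschitz_tuple.
Context (d : measure_display) (T : measurableType d) (R : realType) (n : nat).
Variables (P : probability T R) (X : {mfun T >-> n.-tuple R}) (m : 'I_n -> R).
Hypothesis lawX : indep_normal P X m.

Lemma integrable_coordinate (i : 'I_n) :
  P.-integrable setT (EFin \o (fun w => tnth (X w) i)) /\ \int[P]_w tnth (X w) i = m i.
Proof.
have mY : measurable_fun setT (fun w => tnth (X w) i).
  exact: measurableT_comp (measurable_tnth i) _.
have mY' : @measurable_fun _ _ T (measurableTypeR R) setT (fun w => tnth (X w) i) := mY.
pose Y : {mfun T >-> measurableTypeR R} :=
  HB.pack (fun w => tnth (X w) i) (isMeasurableFun.Build _ _ _ _ _ mY').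
by apply: (@integral_normal_law _ _ _ P Y) => B mB; exact: lawX.2.
Qed.

(** Comparison with the value at the origin bounds [|f x|] by a constant plus a multiple of the sum
    of the [|x_i|], each of which is integrable. *)
Lemma integrable_lipschitz_tuple (L : R) (f : n.-tuple R -> R) :
  measurable_fun setT f ->
  (forall x y, `|f x - f y| <= L * \sum_i `|tnth x i - tnth y i|) ->
  P.-integrable setT (EFin \o (fun w => f (X w))).
Proof.
move=> mf fL.
pose z : n.-tuple R := [tuple 0 | i < n].
have iS : P.-integrable setT (fun w => \sum_(i < n) (`|tnth (X w) i|)%:E)%E.
  apply: integrable_sum => // i _.
  exact: (integrable_norm (integrable_coordinate i).1).
apply: (@le_integrable _ _ _ P setT measurableT _
  (fun w => (`|f z|)%:E + `|L|%:E * \sum_(i < n) (`|tnth (X w) i|)%:E)%E).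
- by apply/measurable_EFinP; exact: measurableT_comp.
- move=> w _ /=.
  rewrite sumEFin -EFinM -EFinD lee_fin [leRHS]ger0_norm; last first.
    by rewrite addr_ge0// mulr_ge0// sumr_ge0.
  have := fL (X w) z.
  under eq_bigr do rewrite tnth_mktuple subr0.
  set S := \sum_i _ => fS.
  have S0 : 0 <= S by rewrite sumr_ge0.
  rewrite -(subrKC (f z) (f (X w))) (le_trans (ler_normD _ _))// lerD2l.
  by rewrite (le_trans fS)// ler_wpM2r// ler_norm.
apply: integrableD => //; last exact: integrableZl.
exact: finite_measure_integrable_cst.
Qed.

End lipschitz_tuple.

(** * Tensorization *)

Lemma lipschitz_continuous (R : realType) (L : R) (f : R -> R) : 0 <= L ->
  (forall x y, f x <= f y + L * `|x - y|) -> continuous f.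
Proof.
move=> L0 fL x; apply/cvgrPdist_le => /= e e0.
have L1 : 0 < L + 1 by rewrite ltr_wpDl.
near=> y.
have xy : `|x - y| <= e / (L + 1).
  by near: y; apply: cvgr_dist_le; [exact: cvg_id|rewrite divr_gt0].
have Lxy : L * `|x - y| <= e.
  rewrite (@le_trans _ _ ((L + 1) * `|x - y|))//; first by rewrite ler_wpM2r// lerDl.
  by rewrite mulrC -ler_pdivlMr.
rewrite ler_norml lerBlDr lerBrDr.
have := fL x y; have := fL y x; rewrite distrC; lra.
Unshelve. all: by end_near. Qed.

(** If the integral were zero, the positive function [expR u] would vanish almost everywhere, making
    the whole space null. Positivity is what allows the logarithm in the tensorization. *)
Lemma integral_expR_gt0 (d : measure_display) (T : measurableType d) (R : realType)
    (P : probability T R) (u : T -> R) : measurable_fun setT u ->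
  (0 < \int[P]_w (expR (u w))%:E)%E.
Proof.
move=> mu; rewrite lt0e integral_ge0 ?andbT; last first.
  by move=> w _; rewrite lee_fin expR_ge0.
have meu : measurable_fun setT (fun w => (expR (u w))%:E).
  by apply/measurable_EFinP; exact: measurableT_comp.
apply/eqP => I0.
have : (\int[P]_w `|(expR (u w))%:E| = 0)%E.
  by rewrite -I0; apply: eq_integral => w _; rewrite gee0_abs// lee_fin expR_ge0.
move/(ae_eq_integral_abs P measurableT meu) => [N [mN PN sN]].
have : P N = 1%E.
  rewrite -(@probability_setT _ _ _ P); congr (P _); rewrite -subTset => w _.
  by apply: sN => /= /(_ I) [] /eqP; rewrite gt_eqF// expR_gt0.
by rewrite PN => /eqP; rewrite eq_sym onee_eq0.
Qed.

Section tuple_cons.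
Context (R : realType) (n : nat).
Implicit Types (y : R) (x : n.-tuple R).

(** [F] is instantiated both by the absolute difference, for the Lipschitz bounds, and by the
    squared difference, for the transport cost. *)
Lemma sum_cons_tuple (F : R -> R -> R) y y' x x' :
  \sum_(i < n.+1) F (tnth [tuple of y :: x] i) (tnth [tuple of y' :: x'] i) =
  F y y' + \sum_(i < n) F (tnth x i) (tnth x' i).
Proof.
by rewrite big_ord_recl !tnth0; congr (_ + _); apply: eq_bigr => i _; rewrite !tnthS.
Qed.

Lemma measurable_cons_tuple d (T : measurableType d) (Y : T -> measurableTypeR R)
    (X : T -> n.-tuple R) : measurable_fun setT Y -> measurable_fun setT X ->
  measurable_fun setT (fun w => [tuple of (Y w : R) :: X w] : n.+1.-tuple R).
Proof. by move=> mY mX; apply: measurable_cons. Qed.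

End tuple_cons.

Section gaussian_infconv_step.
Context (d : measure_display) (T : measurableType d) (R : realType) (n : nat).
Variables (P : probability T R) (X : {mfun T >-> n.+1.-tuple R}) (m : 'I_n.+1 -> R).
Hypothesis lawX : indep_normal P X m.
Local Notation X0 := (tuple_head_mfun X).
Local Notation X' := (tuple_behead_mfun X).

Lemma tuple_cons_head_behead w : [tuple of (X0 w : R) :: X' w] = X w.
Proof. by rewrite [RHS]tuple_eta. Qed.

Lemma distribution_head (A : set (measurableTypeR R)) :
  measurable A -> distribution P X0 A = normal_prob (m ord0) 1 A.
Proof. exact: lawX.2. Qed.

Lemma ge0_integral_cons (F : n.+1.-tuple R -> \bar R) :
  measurable_fun setT F -> (forall x, (0 <= F x)%E) ->
  (\int[P]_w F (X w) =
   \int[normal_prob (m ord0) 1]_y \int[P]_w F [tuple of y :: X' w])%E.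
Proof.
move=> mF F0.
pose G (z : measurableTypeR R * n.-tuple R) := F [tuple of (z.1 : R) :: z.2].
have mG : measurable_fun setT G.
  by apply: measurableT_comp => //; exact: measurable_cons_tuple.
have := ge0_integral_head_behead lawX.1 mG (fun z => F0 _).
rewrite /G/=; under eq_integral do rewrite tuple_cons_head_behead.
move=> ->; apply: eq_measure_integral => A mA _; exact: distribution_head.
Qed.

(** Integrability of the section at every [y], and not only almost every [y], makes the inner
    integral a genuine real function of [y]. Its own integrability is a hypothesis of
    [gaussian_infconv]. *)
Lemma Rintegral_cons (f : n.+1.-tuple R -> R) :
  measurable_fun setT f -> P.-integrable setT (EFin \o (f \o X)) ->
  (forall y, P.-integrable setT (EFin \o (fun w => f [tuple of y :: X' w]))) ->
  (normal_prob (m ord0) 1).-integrable setT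
    (EFin \o (fun y => \int[P]_w f [tuple of y :: X' w])) /\
  \int[P]_w f (X w) =
  \int[normal_prob (m ord0) 1]_y \int[P]_w f [tuple of y :: X' w].
Proof.
move=> mf iF ify.
pose G (z : measurableTypeR R * n.-tuple R) := (f [tuple of (z.1 : R) :: z.2])%:E.
have mG : measurable_fun setT G.
  apply/measurable_EFinP; apply: measurableT_comp => //; exact: measurable_cons_tuple.
have iG : P.-integrable setT (G \o head_behead_pair X).
  by apply: eq_integrable iF => // w _; rewrite /G/= tuple_cons_head_behead.
have [E1 E2] := integral_head_behead lawX.1 mG iG.
have inner y : (\int[distribution P X']_x G (y, x))%E =
    (\int[P]_w f [tuple of (y : R) :: X' w])%:E.
  rewrite integral_distribution; last 2 first.
  - by apply: measurableT_comp mG _; exact: pair1_measurable.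
  - exact: ify.
  by rewrite /Rintegral fineK//; exact: integrable_fin_num (ify y).
rewrite (funext inner) in E1 E2.
move: E1; rewrite /G/=; under eq_integral do rewrite tuple_cons_head_behead.
move=> E1; split; last first.
  rewrite /Rintegral; congr fine; rewrite E1.
  by apply: eq_measure_integral => A mA _; exact: distribution_head.
move/integrableP : E2 => [mE2 E2]; apply/integrableP; split => //.
move: E2; rewrite (eq_measure_integral (normal_prob (m ord0) 1))// => A mA _.
exact: distribution_head.
Qed.

End gaussian_infconv_step.

(** The Lipschitz hypotheses are inherited by the marginals of [f] and [h], whatever the constant.
    They supply integrability of [f] at each stage and the continuity required in dimension one; [L]
    does not enter the bound. *)
Theorem gaussian_infconv_tuple (d : measure_display) (T : measurableType d)
    (R : realType) (P : probability T R) (L : R) : 0 <= L ->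
  forall (n : nat) (X : {mfun T >-> n.-tuple R}) (m : 'I_n -> R)
    (f h : n.-tuple R -> R),
  indep_normal P X m ->
  measurable_fun setT f -> measurable_fun setT h ->
  (forall x y, `|f x - f y| <= L * \sum_i `|tnth x i - tnth y i|) ->
  (forall x y, `|h x - h y| <= L * \sum_i `|tnth x i - tnth y i|) ->
  (forall x y, h x <= f y + (\sum_i (tnth x i - tnth y i) ^+ 2) / 2) ->
  (\int[P]_w (expR (h (X w)))%:E <= (expR (\int[P]_w f (X w)))%:E)%E.
Proof.
move=> L0; elim=> [|n IH] X m f h lawX mf mh fL hL hf.
  under eq_integral do rewrite (tuple0 (X _)).
  under [in leRHS]eq_Rintegral do rewrite (tuple0 (X _)).
  rewrite integral_cst// Rintegral_cst//= probability_setT mule1 mulr1 lee_fin ler_expR.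
  by have := hf [tuple] [tuple]; rewrite big_ord0 mul0r addr0.
have lawX' := indep_normal_behead lawX.
pose X' := tuple_behead_mfun X.
have mcons y : measurable_fun setT
    (fun x : n.-tuple R => [tuple of y :: x] : n.+1.-tuple R).
  by apply: measurable_cons.
have consL (g : n.+1.-tuple R -> R) y :
    (forall x y, `|g x - g y| <= L * \sum_i `|tnth x i - tnth y i|) ->
    forall x x' : n.-tuple R, `|g [tuple of y :: x] - g [tuple of y :: x']| <=
      L * \sum_i `|tnth x i - tnth x' i|.
  move=> gL x x'; apply: le_trans (gL _ _) _.
  by rewrite (sum_cons_tuple (fun a b => `|a - b|)) subrr normr0 add0r.
have headL (g : n.+1.-tuple R -> R) :
    (forall x y, `|g x - g y| <= L * \sum_i `|tnth x i - tnth y i|) ->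
    forall (y y' : R) (x : n.-tuple R),
      g [tuple of y :: x] <= g [tuple of y' :: x] + L * `|y - y'|.
  move=> gL y y' x; have := gL [tuple of y :: x] [tuple of y' :: x].
  rewrite (sum_cons_tuple (fun a b => `|a - b|)) big1 ?addr0; last first.
    by move=> i _; rewrite subrr normr0.
  by rewrite ler_norml => /andP[_]; rewrite lerBlDl addrC.
have ify y : P.-integrable setT (EFin \o (fun w => f [tuple of y :: X' w])).
  apply: (integrable_lipschitz_tuple lawX' (L := L)
    (f := fun x => f [tuple of y :: x])).
    exact: measurableT_comp mf (mcons y).
  exact: consL.
have iF : P.-integrable setT (EFin \o (f \o X)).
  exact: (integrable_lipschitz_tuple lawX mf fL).
have [iFg Ef] := Rintegral_cons lawX mf iF ify.
pose g y := \int[P]_w f [tuple of y :: X' w].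
pose I y := (\int[P]_w (expR (h [tuple of y :: X' w]))%:E)%E.
have mhy y : measurable_fun setT (fun w => h [tuple of y :: X' w]).
  by apply: measurableT_comp mh _; apply: measurableT_comp (mcons y) _.
have meh y : measurable_fun setT (fun w => (expR (h [tuple of y :: X' w]))%:E).
  by apply/measurable_EFinP; exact: measurableT_comp.
(* For fixed heads [y] and [y'], the head's share of the quadratic cost is a constant. It is
   absorbed into [f'], and the induction hypothesis handles the tails. *)
have Ig y y' : (I y <= (expR (g y' + (y - y') ^+ 2 / 2))%:E)%E.
  pose f' (x : n.-tuple R) := f [tuple of y' :: x] + (y - y') ^+ 2 / 2.
  have -> : g y' + (y - y') ^+ 2 / 2 = \int[P]_w f' (X' w).
    rewrite RintegralD//; last exact: finite_measure_integrable_cst.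
    by rewrite Rintegral_cst//= probability_setT mulr1.
  apply: (IH X' _ f' (fun x : n.-tuple R => h [tuple of y :: x]) lawX').
  - apply: measurable_funD => //; exact: measurableT_comp mf (mcons _).
  - exact: measurableT_comp mh (mcons _).
  - move=> x x'; rewrite /f' opprD addrACA subrr addr0; exact: consL.
  - exact: consL.
  - move=> x x'; apply: le_trans (hf _ [tuple of y' :: x']) _.
    by rewrite (sum_cons_tuple (fun a b => (a - b) ^+ 2)) /f' mulrDl addrA.
have I0 y : (0 < I y)%E by exact: integral_expR_gt0.
have Ifin y : I y \is a fin_num.
  by rewrite ge0_fin_numE ?ltW// (le_lt_trans (Ig y y))// ltry.
(* [k] is the log-Laplace marginal of [h], real-valued because [I y] is positive and finite. *)
have [k kE] : exists k : R -> R, forall y, (expR (k y))%:E = I y.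
  exists (fun y => ln (fine (I y))) => y.
  by rewrite lnK ?fineK// posrE fine_gt0// I0 -ge0_fin_numE ?Ifin// ltW.
(* Changing the head multiplies the integrand by at most [expR (L * |y - y'|)], hence the integral
   too. *)
have kL y y' : k y <= k y' + L * `|y - y'|.
  rewrite -ler_expR expRD -lee_fin EFinM (kE y) (kE y') muleC.
  rewrite -ge0_integralZl// ?lee_fin ?expR_ge0//.
  apply: ge0_le_integral => //.
  - by apply: emeasurable_funM.
  - move=> w _; rewrite -EFinM lee_fin -expRD ler_expR addrC.
    exact: headL.
have gL y y' : g y <= g y' + L * `|y - y'|.
  have -> : g y' + L * `|y - y'| = \int[P]_w (f [tuple of y' :: X' w] + L * `|y - y'|).
    rewrite RintegralD//; last exact: finite_measure_integrable_cst.
    by rewrite Rintegral_cst//= probability_setT mulr1.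
  apply: le_Rintegral => //.
  - rewrite (_ : _ \o _ = (EFin \o (fun w => f [tuple of y' :: X' w])) \+
      (EFin \o cst (L * `|y - y'|)%R))%E//.
    by apply: integrableD => //; exact: finite_measure_integrable_cst.
  - by move=> w _; exact: headL.
rewrite (ge0_integral_cons lawX (F := fun x => (expR (h x))%:E)); last 2 first.
- by apply/measurable_EFinP; exact: measurableT_comp.
- by move=> x; rewrite lee_fin expR_ge0.
rewrite Ef.
have kg y y' : k y <= g y' + (y - y') ^+ 2 / 2.
  by rewrite -ler_expR -lee_fin (kE y); exact: Ig.
have ck := lipschitz_continuous L0 kL; have cg := lipschitz_continuous L0 gL.
have := gaussian_infconv ck cg iFg kg.
by rewrite (funext kE).
Qed.

(** * Concentration and the maximum test *)

(** The Euclidean norm is at most the sum norm, so a Euclidean Lipschitz bound yields the one used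
    in the tensorization. *)
Lemma sqr_sum_norm_ge (R : realDomainType) (I : finType) (u : I -> R) :
  \sum_i u i ^+ 2 <= (\sum_i `|u i|) ^+ 2.
Proof.
rewrite expr2 mulr_suml; apply: ler_sum => i _.
rewrite -real_normK ?num_real// expr2 ler_wpM2l//.
by rewrite (bigD1 i)//= lerDl sumr_ge0.
Qed.

Section concentration.
Context (d : measure_display) (T : measurableType d) (R : realType) (n : nat).
Variables (P : probability T R) (X : {mfun T >-> n.-tuple R}) (m : 'I_n -> R).
Hypothesis lawX : indep_normal P X m.

(** Chernoff's method. With [u = f x - f y], the inequality [l * u <= l ^+ 2 * V / 2 + u ^+ 2 / (2 *
    V)] makes [l * f] minus the constant [l ^+ 2 * V / 2] admissible against [l * f]. This bounds
    the Laplace transform of [f], and Markov's inequality concludes. *)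
Theorem gaussian_concentration (f : n.-tuple R -> R) (V t : R) :
  measurable_fun setT f -> 0 < V -> 0 <= t ->
  (forall x y, (f x - f y) ^+ 2 <= V * \sum_i (tnth x i - tnth y i) ^+ 2) ->
  (P [set w | \int[P]_v f (X v) + t <= f (X w)]%R <=
   (expR (- (t ^+ 2 / (V *+ 2))))%:E)%E.
Proof.
move=> mf V0 t0 fV.
set E := \int[P]_v f (X v).
have fL x y : `|f x - f y| <= Num.sqrt V * \sum_i `|tnth x i - tnth y i|.
  have S0 : 0 <= \sum_i `|tnth x i - tnth y i| by rewrite sumr_ge0.
  rewrite -(@ler_pXn2r _ 2)// ?nnegrE ?mulr_ge0 ?sqrtr_ge0//.
  rewrite real_normK ?num_real// exprMn sqr_sqrtr ?(ltW V0)//.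
  by rewrite (le_trans (fV x y))// ler_wpM2l ?(ltW V0)// sqr_sum_norm_ge.
(* This minimizes the Chernoff exponent [l ^+ 2 * V / 2 - l * t], with value
   [- t ^+ 2 / (2 * V)]. *)
pose l := t / V.
have l0 : 0 <= l by rewrite divr_ge0 ?(ltW V0).
pose F x := l * f x; pose h x := F x - l ^+ 2 * V / 2.
have mF : measurable_fun setT F by exact: measurable_funM.
have mh : measurable_fun setT h by exact: measurable_funB.
have FL x y : `|F x - F y| <= (l * Num.sqrt V) * \sum_i `|tnth x i - tnth y i|.
  by rewrite -mulrBr normrM ger0_norm// -mulrA ler_wpM2l.
have iff : P.-integrable setT (EFin \o (fun w => f (X w))).
  exact: (integrable_lipschitz_tuple lawX mf fL).
have EF : \int[P]_w F (X w) = l * E by rewrite RintegralZl.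
have infc : (\int[P]_w (expR (h (X w)))%:E <= (expR (l * E))%:E)%E.
  rewrite -EF; apply: (gaussian_infconv_tuple _ lawX mF mh FL).
  - by rewrite mulr_ge0 ?sqrtr_ge0.
  - by move=> x y; rewrite /h opprB addrA subrK FL.
  - move=> x y; rewrite /h /F; have := fV x y.
    set D := \sum_i _; set u := f x - f y => uVD.
    have : u ^+ 2 / V <= D by rewrite ler_pdivrMr// mulrC.
    have : 0 <= (l * V - u) ^+ 2 / V by rewrite divr_ge0 ?sqr_ge0 ?(ltW V0).
    have -> : (l * V - u) ^+ 2 / V = l ^+ 2 * V - l * u *+ 2 + u ^+ 2 / V.
      by field; rewrite gt_eqF.
    have -> : l * f x = l * f y + l * u by rewrite /u; ring.
    lra.
set A := [set w | E + t <= f (X w)].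
have mA : measurable A.
  rewrite -[A]setTI; apply: measurable_fun_ler => //.
  exact: measurableT_comp.
(* [c] is a lower bound for [h (X w)] on [A], as Markov's inequality requires. *)
pose c := l * (E + t) - l ^+ 2 * V / 2.
have meh : measurable_fun setT (fun w => (expR (h (X w)))%:E).
  by apply/measurable_EFinP; do 2 apply: measurableT_comp => //.
have : ((expR c)%:E * P A <= \int[P]_w (expR (h (X w)))%:E)%E.
  rewrite -integral_cst//.
  apply: (@le_trans _ _ (\int[P]_(w in A) (expR (h (X w)))%:E)%E).
    apply: ge0_le_integral => //.
    - by move=> w _; rewrite lee_fin expR_ge0.
    - exact: measurable_funTS.
    - move=> w Aw; rewrite lee_fin ler_expR lerD2r ler_wpM2l//.
  by apply: ge0_subset_integral => // w _; rewrite lee_fin expR_ge0.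
move=> /le_trans/(_ infc); rewrite muleC -lee_pdivlMr ?expR_gt0//.
move=> /le_trans; apply.
rewrite -EFinM lee_fin -expRN -expRD ler_expR /c /l.
rewrite le_eqVlt; apply/orP; left; apply/eqP.
by field; rewrite gt_eqF.
Qed.

End concentration.

(** * Lipschitz bounds for coordinate sums and their maximum *)

Section coordinate_sums.
Context (R : realType) (n K : nat) (C : {set {set 'I_n}}).
Implicit Types (x y : n.-tuple R) (S : {set 'I_n}).

Lemma measurable_coord_sum S :
  measurable_fun setT (fun x : n.-tuple R => coord_sum x S).
Proof.
under eq_fun do rewrite /coord_sum big_mkcond /=.
apply: (@measurable_sum _ _ R setT _ _
  (fun i (x : n.-tuple R) => if i \in S then tnth x i else 0)).
by move=> i; case: (i \in S) => //; exact: measurable_tnth.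
Qed.

(** Cauchy-Schwarz over the [K] coordinates of [S], proved by expanding the square and using
    [u i * u j <= u i ^+ 2 / 2 + u j ^+ 2 / 2]. *)
Lemma coord_sum_lipschitz S x y : #|S| = K ->
  (coord_sum x S - coord_sum y S) ^+ 2 <=
  K%:R * \sum_i (tnth x i - tnth y i) ^+ 2.
Proof.
move=> SK; rewrite /coord_sum -sumrB; pose u i := tnth x i - tnth y i.
rewrite -[X in X ^+ 2 <= _]/(\sum_(i in S) u i).
apply: (@le_trans _ _ (K%:R * \sum_(i in S) u i ^+ 2)); last first.
  rewrite ler_wpM2l// [leRHS](bigID [in S])/= lerDl.
  by rewrite sumr_ge0// => i _; exact: sqr_ge0.
rewrite expr2 mulr_suml; under eq_bigr do rewrite mulr_sumr.
apply: (@le_trans _ _ (\sum_(i in S) \sum_(j in S) (u i ^+ 2 / 2 + u j ^+ 2 / 2))).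
  apply: ler_sum => i _; apply: ler_sum => j _.
  by have := sqr_ge0 (u i - u j); lra.
under eq_bigr do rewrite big_split/= sumr_const SK.
rewrite big_split/= sumrMnl -mulr_suml sumr_const SK -mulrnDl.
by rewrite -splitr mulr_natl.
Qed.

(** If the maximum is larger at [x] and attained there at [S], its increment is at most that of the
    single sum over [S]. Taking a maximum thus costs nothing, and [N] does not appear in the
    bound. *)
Lemma max_coord_sum_lipschitz x y : C != finset.set0 ->
  (forall S, S \in C -> #|S| = K) ->
  (max_coord_sum C x - max_coord_sum C y) ^+ 2 <=
  K%:R * \sum_i (tnth x i - tnth y i) ^+ 2.
Proof.
move=> C0 CK.
wlog xy : x y / max_coord_sum C y <= max_coord_sum C x.
  move=> H; have [/H//|/ltW/H] := leP (max_coord_sum C y) (max_coord_sum C x).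
  rewrite -sqrrN opprB; under eq_bigr do rewrite -sqrrN opprB.
  by [].
have [S SC Sx] := max_coord_sum_attained x C0.
apply: le_trans (coord_sum_lipschitz x y (CK S SC)).
have Sy := max_coord_sum_ub y SC.
have xS : max_coord_sum C x - max_coord_sum C y <= coord_sum x S - coord_sum y S.
  by rewrite Sx lerD2l lerN2.
have max0 : 0 <= max_coord_sum C x - max_coord_sum C y by rewrite subr_ge0.
by rewrite ler_sqr// nnegrE (le_trans max0).
Qed.

End coordinate_sums.

(** Let [s] be the square root in the hypothesis. The hypothesis says [t >= K * s], and
    [(K * s) ^+ 2 / (2 * K)] is exactly [ln (2 / delta)]. *)
Lemma gaussian_tail_threshold (R : realType) (K : nat) (mu E delta : R) :
  (1 <= K)%N -> 0 < delta -> delta <= 2 ->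
  mu >= E / K%:R + 2 * Num.sqrt (2 / K%:R * ln (2 / delta)) ->
  let t := (mu * K%:R - E) / 2 in
  0 <= t /\ expR (- (t ^+ 2 / (K%:R *+ 2))) <= delta / 2.
Proof.
move=> K1 d0 d2 hmu t.
have K0 : 0 < K%:R :> R by rewrite ltr0n.
(* Here [delta <= 2] enters: the radicand is nonnegative, so that squaring the root gives it
   back. *)
have l0 : 0 <= ln (2 / delta) by rewrite ln_ge0// ler_pdivlMr// mul1r.
set s := Num.sqrt _ in hmu.
have s0 : 0 <= s by exact: sqrtr_ge0.
have ss : s ^+ 2 = 2 / K%:R * ln (2 / delta).
  by rewrite sqr_sqrtr// mulr_ge0// divr_ge0// ltW.
have ts : K%:R * s <= t.
  move: hmu; rewrite -lerBrDl -(ler_pM2l K0) mulrBr => h.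
  have EK : K%:R * (E / K%:R) = E by rewrite mulrC divfK ?gt_eqF.
  rewrite /t; rewrite EK in h; lra.
have t0 : 0 <= t by rewrite (le_trans _ ts)// mulr_ge0// ltW.
split=> //.
have -> : delta / 2 = expR (- ln (2 / delta)).
  by rewrite expRN lnK ?posrE ?divr_gt0// invf_div.
rewrite ler_expR lerN2 ler_pdivlMr ?mulrn_wgt0//.
have : (K%:R * s) ^+ 2 <= t ^+ 2 by rewrite ler_sqr ?nnegrE// mulr_ge0// ltW.
apply: le_trans; rewrite exprMn ss le_eqVlt; apply/orP; left; apply/eqP.
by field; rewrite gt_eqF.
Qed.

Section mean_coord_sum.
Context (d : measure_display) (T : measurableType d) (R : realType) (n : nat).
Variables (P : probability T R) (X : {mfun T >-> n.-tuple R}) (m : 'I_n -> R).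
Hypothesis lawX : indep_normal P X m.

Lemma integrable_coord_sum (S : {set 'I_n}) :
  P.-integrable setT (EFin \o (fun w => coord_sum (X w) S)).
Proof.
rewrite (_ : _ \o _ = fun w => (\sum_(i in S) (tnth (X w) i)%:E)%E).
  by apply: integrable_sum => // i _; exact: (integrable_coordinate lawX i).1.
by apply/funext => w; rewrite /coord_sum/= sumEFin.
Qed.

Lemma Rintegral_coord_sum (S : {set 'I_n}) :
  \int[P]_w coord_sum (X w) S = \sum_(i in S) m i.
Proof.
rewrite /Rintegral /coord_sum.
under eq_integral do rewrite -sumEFin.
rewrite integral_sum//; last first.
  by move=> i; exact: (integrable_coordinate lawX i).1.
rewrite -sum_fine; last first.
  by move=> i _; exact: integrable_fin_num (integrable_coordinate lawX i).1.
apply: eq_bigr => i _; exact: (integrable_coordinate lawX i).2.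
Qed.

End mean_coord_sum.

Theorem proposition2p2 (R : realType) (n K : nat) (C : {set {set 'I_n}})
  (n_ge1 : (1 <= n)%N) (K_ge1 : (1 <= K)%N) (N_ge1 : (1 <= #|C|)%N)
  (card_C : forall S : {set 'I_n}, S \in C -> #|S| = K)
  (mu : R) (mu_gt0 : 0 < mu)
  (d : measure_display) (T : measurableType d)
  (X : {mfun T >-> n.-tuple R})
  (P0 : probability T R) (P : {set 'I_n} -> probability T R)
  (P0_law : indep_normal P0 X (fun=> 0))
  (P_law : forall S : {set 'I_n}, S \in C ->
    indep_normal (P S) X (shifted_mean mu S))
  (delta : R) (delta_gt0 : 0 < delta) (delta_le2 : delta <= 2) :
  let E0max : R := fine 'E_P0[fun w => max_coord_sum C (X w)] in
  let f : {mfun n.-tuple R >-> bool} :=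
    max_test C ((mu * K%:R + E0max) / 2) in
  mu >= E0max / K%:R + 2 * Num.sqrt (2 / K%:R * ln (2 / delta)) ->
  (risk C P0 P X f <= delta%:E)%E.
Proof.
move=> E0max f mu_ge.
have C0 : C != finset.set0 by rewrite -card_gt0.
have K0 : 0 < K%:R :> R by rewrite ltr0n.
have E0maxE : E0max = \int[P0]_w max_coord_sum C (X w) by rewrite /E0max unlock.
have [t0 tail] := gaussian_tail_threshold K_ge1 delta_gt0 delta_le2 mu_ge.
set t := (mu * K%:R - E0max) / 2 in t0 tail.
(* The rejection event is exactly the upper deviation event of the maximum, since [E0max + t] is the
   threshold. *)
have typeI : (P0 [set w | f (X w) = true] <= (delta / 2)%:E)%E.
  have := gaussian_concentration P0_law (@measurable_max_coord_sum R n C) K0 t0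
    (fun x y => max_coord_sum_lipschitz x y C0 card_C).
  rewrite -E0maxE => H; apply: le_trans (le_trans H _); last by rewrite lee_fin.
  rewrite le_eqVlt; apply/orP; left; apply/eqP; congr (P0 _).
  apply/seteqP; split => w /=; rewrite /f/= /max_test;
    by have -> : E0max + t = (mu * K%:R + E0max) / 2 by rewrite /t; field.
(* The threshold is also [mu * K - t]. Acceptance forces [x_S] below it, so [- x_S] exceeds its mean
   [- (mu * K)] under [P S] by at least [t]. *)
have typeII S : S \in C -> (P S [set w | f (X w) = false] <= (delta / 2)%:E)%E.
  move=> SC.
  have mN : measurable_fun setT (fun x : n.-tuple R => - coord_sum x S).
    by apply: measurableT_comp => //; exact: measurable_coord_sum.
  have lipN (x y : n.-tuple R) : (- coord_sum x S - - coord_sum y S) ^+ 2 <=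
      K%:R * \sum_i (tnth x i - tnth y i) ^+ 2.
    by rewrite -opprD sqrrN; exact: coord_sum_lipschitz (card_C S SC).
  have := gaussian_concentration (P_law S SC) mN K0 t0 lipN.
  have -> : \int[P S]_v - coord_sum (X v) S = - (mu * K%:R).
    transitivity (- \int[P S]_v coord_sum (X v) S).
      rewrite -mulN1r -RintegralZl//; last exact: integrable_coord_sum (P_law S SC) S.
      by apply: eq_Rintegral => w _; rewrite mulN1r.
    congr (- _); rewrite (Rintegral_coord_sum (P_law S SC)).
    rewrite (eq_bigr (fun=> mu)); last by move=> i iS; rewrite /shifted_mean iS.
    by rewrite sumr_const (card_C S SC) mulr_natr.
  move=> H; apply: le_trans (le_trans H _); last by rewrite lee_fin.
  apply: le_measure; rewrite ?inE.
  - apply: (@measurable_funPTI _ _ _ _ X (f @^-1` [set false])).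
    exact: measurable_funPTI.
  - rewrite -[X in measurable X]setTI; apply: measurable_fun_ler => //.
    exact: measurableT_comp mN _.
  - move=> w /=; rewrite /f/= /max_test => /negbT; rewrite -ltNge => maxlt.
    have := max_coord_sum_ub (X w) SC; rewrite /t; lra.
rewrite /risk (_ : delta = delta / 2 + delta / 2); last by rewrite -splitr.
rewrite EFinD leeD//.
(* The bound [delta / 2] is uniform in [S], so it survives averaging over the nonempty class. *)
apply: (@le_trans _ _ ((#|C|%:R^-1)%:E * \sum_(S in C) (delta / 2)%:E)%E).
  by rewrite lee_wpmul2l ?lee_fin ?invr_ge0// lee_sum.
rewrite sumEFin -EFinM lee_fin sumr_const -[delta / 2 *+ _]mulr_natl.
by rewrite mulKf// pnatr_eq0 -lt0n.
Qed.
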